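(* Let $(\mathbf{g}_k,\mathbf{q}_k)$, the component on edge $e_k$ of a state $\mathbf{z}=(\mathbf{g},\mathbf{q})$, be fixed, and for $\beta>0$ let the weights be given by the Gibbs distribution $$w_n(e_k)=\frac{\exp(-\beta\,d_{k,n}^2)}{\sum_{m=1}^{\mathcal{N}_m}\exp(-\beta\,d_{k,m}^2)},\qquad d_{k,n}^2=C_k(\mathbf{g}_k-g_n)^2+C_k^{-1}(\mathbf{q}_k-q_n)^2,\qquad n=1,\dots,\mathcal{N}_m,$$ with soft target $(\tilde{\mathbf{g}}_k,\tilde{\mathbf{q}}_k)=\sum_{n=1}^{\mathcal{N}_m}w_n(e_k)\,(g_n,q_n)$. Then: (i) As $\beta\to0^{+}$, $w_n(e_k)\to 1/\mathcal{N}_m$ for all $n$, so the soft target converges to the data centroid $$(\tilde{\mathbf{g}}_k,\tilde{\mathbf{q}}_k)\to\frac{1}{\mathcal{N}_m}\sum_{n=1}^{\mathcal{N}_m}(g_n,q_n),$$ which is independent of $(\mathbf{g}_k,\mathbf{q}_k)$ and hence of the initialization. (ii) If the nearest neighbor $n^{\ast}:=\arg\min_n d_{k,n}^2$ is unique, then as $\beta\to\infty$, $w_{n^{\ast}}(e_k)\to1$ and $w_n(e_k)\to0$ for $n\neq n^{\ast}$, so $$P_{\mathcal{Z}}^{\beta}(\mathbf{z})\to P_{\mathcal{Z}}(\mathbf{z}),$$ i.e., the soft projection recovers the hard nearest-neighbor projection of the Alternating Direction Method. Moreover, writing $d_{(1)}^2\le d_{(2)}^2$ for the two smallest distances on edge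 $e_k$, the approach to the hard limit is governed by their gap, $$1-w_{n^{\ast}}(e_k)=\mathcal{O}\!\Big(\exp\!\big[-\beta\,\big(d_{(2)}^2-d_{(1)}^2\big)\big]\Big),$$ so that the terminal temperature required to resolve the assignment grows as the two closest candidates come together.
   Context: A hydraulic network has edges $e_1,\dots,e_{n_e}$. A state $\mathbf{z}=(\mathbf{g},\mathbf{q})\in\mathbb{R}^{n_e}\times\mathbb{R}^{n_e}$ consists of edge-wise pressure gradients $\mathbf{g}$ and fluxes $\mathbf{q}$, with $k$-th entries $\mathbf{g}_k,\mathbf{q}_k$. The dataset $\mathcal{D}=\{(g_n,q_n)\}_{n=1}^{\mathcal{N}_m}\subset\mathbb{R}^2$ is a finite set of measured gradient/flux pairs shared by all edges. The numbers $C_k>0$ are the diagonal entries of a positive-definite diagonal matrix $\mathbf{C}$, which induces the squared distance $\|\mathbf{z}-\tilde{\mathbf{z}}\|_{\mathbf{C}}^2=\sum_{k=1}^{n_e}\big[C_k(\mathbf{g}_k-\tilde{\mathbf{g}}_k)^2+C_k^{-1}(\mathbf{q}_k-\tilde{\mathbf{q}}_k)^2\big]$. The constitutive-data set $\mathcal{Z}$ is the set of all $\tilde{\mathbf{z}}=(\tilde{\mathbf{g}},\tilde{\mathbf{q}})$ with $(\tilde{\mathbf{g}}_k,\tilde{\mathbf{q}}_k)\in\mathcal{D}$ for every $k$. The hard projection $P_{\mathcal{Z}}(\mathbf{z})=\arg\min_{\tilde{\mathbf{z}}\in\mathcal{Z}}\|\tilde{\mathbf{z}}-\mathbf{z}\|_{\mathbf{C}}^2$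 decouples over edges: on edge $e_k$ it selects the pair $(g_n,q_n)$ minimizing $d_{k,n}^2$. The soft projection $P_{\mathcal{Z}}^{\beta}$ at inverse temperature $\beta>0$ is likewise defined edge by edge: on edge $e_k$ it returns the soft target $\sum_n w_n(e_k)(g_n,q_n)$ built from the Gibbs weights of the claim. The Alternating Direction Method alternates $P_{\mathcal{Z}}$ with the projection $P_{\mathcal{A}}$ (in the same distance) onto the affine set $\mathcal{A}$ of states satisfying mass balance, compatibility of gradients with nodal pressures, and prescribed boundary pressures, starting from an initial data assignment (the initialization). Deterministic annealing replaces $P_{\mathcal{Z}}$ by $P_{\mathcal{Z}}^{\beta}$ and increases $\beta$ along the iterations up to a final value $\beta_{\max}$; ''terminal temperature'' refers to this terminal value $\beta_{\max}$ of the inverse temperature, and ''resolving the assignment'' means that the weights on an edge have concentrated on a single data pair. *)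

(* Defs.v *)
From HB Require Import structures.
From mathcomp Require Import all_boot all_order all_algebra.
From mathcomp Require Import all_classical all_reals all_analysis.
Import Order.TTheory GRing.Theory Num.Theory.
Import numFieldNormedType.Exports.

Set Implicit Arguments.
Unset Strict Implicit.
Unset Printing Implicit Defensive.

Local Open Scope classical_set_scope.
Local Open Scope ring_scope.

(* Lets the Landau notations be used at +oo. *)
Canonical pinfty_filter_on (R : numFieldType) :=
  FilterType (pinfty_nbhs R) _.

Section edge.
Context {R : realType}.

(* [x] and [y] are (gradient, flux) pairs. *)
Definition edge_sqdist (c : R) (x y : R * R) : R :=
  c * (x.1 - y.1) ^+ 2 + c^-1 * (x.2 - y.2) ^+ 2.

Context {N : nat}.
Implicit Types (c beta eps : R) (dat : 'I_N -> R * R) (x : R * R).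

Definition gibbs c dat x beta (n : 'I_N) : R :=
  expR (- (beta * edge_sqdist c x (dat n))) /
  \sum_(m < N) expR (- (beta * edge_sqdist c x (dat m))).

Definition soft_target c dat x beta : R * R :=
  (\sum_(n < N) gibbs c dat x beta n * (dat n).1,
   \sum_(n < N) gibbs c dat x beta n * (dat n).2).

Definition centroid dat : R * R :=
  (N%:R^-1 * \sum_(n < N) (dat n).1, N%:R^-1 * \sum_(n < N) (dat n).2).

Definition nearest c dat x : set 'I_N :=
  [set n | forall m, edge_sqdist c x (dat n) <= edge_sqdist c x (dat m)].

(* Order statistics of the squared distances, counted with multiplicity and
   from 0: [ordered_sqdist c dat x 0] is d_(1)^2 and
   [ordered_sqdist c dat x 1] is d_(2)^2, which is meaningful for 1 < N. *)
Definition ordered_sqdist c dat x (j : nat) : R :=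
  nth 0 (sort <=%R [seq edge_sqdist c x (dat n) | n <- enum 'I_N]) j.

Definition gap c dat x : R :=
  ordered_sqdist c dat x 1 - ordered_sqdist c dat x 0.

(* The weights have concentrated on a single pair, up to a tolerance eps. *)
Definition resolved c dat x eps beta : Prop :=
  exists n, 1 - eps <= gibbs c dat x beta n.

(* The least terminal inverse temperature that resolves the assignment; [inf]
   is 0 on the empty set, so a positive value entails that the assignment can
   be resolved. *)
Definition terminal_beta c dat x eps : R :=
  inf [set beta | 0 < beta /\ resolved c dat x eps beta].

End edge.

Section network.
Context {R : realType} {ne : nat}.

Implicit Types (C : 'I_ne -> R) (z : 'rV[R]_ne * 'rV[R]_ne).

Definition edge z (k : 'I_ne) : R * R := (z.1 ord0 k, z.2 ord0 k).

Definition sqdist C z z' : R :=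
  \sum_(k < ne) edge_sqdist (C k) (edge z k) (edge z' k).

Definition argmin C (S : set ('rV[R]_ne * 'rV[R]_ne)) z :=
  [set zt | S zt /\ forall z', S z' -> sqdist C zt z <= sqdist C z' z].

(* Some minimizer, when there is one; the default value [z] is immaterial. *)
Definition proj C (S : set ('rV[R]_ne * 'rV[R]_ne)) z :=
  xget z (argmin C S z).

Context {N : nat}.
Implicit Types (dat : 'I_N -> R * R).

Definition data_states dat : set ('rV[R]_ne * 'rV[R]_ne) :=
  [set zt | forall k, range dat (edge zt k)].

Definition hard_proj C dat z := proj C (data_states dat) z.

Definition soft_proj C dat (beta : R) z : 'rV[R]_ne * 'rV[R]_ne :=
  (\row_k (soft_target (C k) dat (edge z k) beta).1,
   \row_k (soft_target (C k) dat (edge z k) beta).2).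

Definition assigned dat (a : 'I_ne -> 'I_N) : 'rV[R]_ne * 'rV[R]_ne :=
  (\row_k (dat (a k)).1, \row_k (dat (a k)).2).

(* The states produced by the annealed alternating projections onto the
   admissible set [A] and onto the data, from the initial assignment [a] and
   along the schedule [sched] of inverse temperatures. *)
Fixpoint annealed_state C dat (A : set ('rV[R]_ne * 'rV[R]_ne))
    (sched : nat -> R) (a : 'I_ne -> 'I_N) (j : nat) :
    'rV[R]_ne * 'rV[R]_ne :=
  if j is i.+1
  then proj C A (soft_proj C dat (sched i)
                   (annealed_state C dat A sched a i))
  else proj C A (assigned dat a).

End network.

(* Main.v *)
Require Import Defs.
From HB Require Import structures.
From mathcomp Require Import all_boot all_order all_algebra.
From mathcomp Require Import all_classical all_reals all_analysis.
From mathcomp Require Import ring lra.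
Import Order.TTheory GRing.Theory Num.Theory.
Import numFieldNormedType.Exports.

(** Dividing numerator and denominator of a Gibbs weight by its numerator gives
    w_n(beta) = 1 / sum_m exp (- beta (d_m - d_n)), where d_m is the squared
    distance to the m-th data pair ([gibbsE]).  This is continuous in beta on
    the whole line and equals 1/N at beta = 0, which yields the centroid in
    the limit beta -> 0+, whatever the state.

    If ns is the unique nearest pair, then in the sum for n = ns every term
    with m <> ns decays exponentially, so the sum tends to 1 as beta -> +oo;
    the other weights are squeezed between 0 and 1 - w_ns.  Since d_(1) = d_ns
    and d_(2) is the minimum of d_m over m <> ns, comparing the terms with
    exp (- beta gap) gives

      1 - w_ns <= (N - 1) exp (- beta gap)  for beta >= 0
                                              ([gibbs_gap_le]),
      w_ns <= 1 / (1 + exp (- beta gap))      ([gibbs_nearest_le]).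

    The hard projection is edgewise: replacing the data pair of a single edge
    changes only that edge's term of the squared distance, so a data state is
    a minimizer exactly when it picks a nearest pair on each edge
    ([argmin_data_statesP]).  Limits of states are then taken edge by edge.

    For the terminal inverse temperature with tolerance eps < 1/2, no pair
    other than ns can reach weight 1 - eps, as it never outweighs ns.  Hence
    resolution means w_ns >= 1 - eps, and the upper bound on w_ns forces
    beta >= ln ((1 - eps) / eps) / gap ([terminal_beta_ge]), which blows up as
    the gap closes.  For strict monotonicity, shrinking the gap by moving a
    single competitor closer strictly lowers w_ns at every beta > 0.  The
    infimum that defines the terminal value is attained, so at the terminal
    value of the smaller gap the configuration with the larger gap has weight
    strictly above 1 - eps, and by continuity it is already resolved at some
    smaller beta ([terminal_beta_lt_close]). *)

Set Implicit Arguments.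
Unset Strict Implicit.
Unset Printing Implicit Defensive.

Local Open Scope classical_set_scope.
Local Open Scope ring_scope.

(** * Gibbs weights on one edge *)

Section weights.
Context {R : realType} {N : nat}.
Variables (c : R) (dat : 'I_N -> R * R) (x : R * R).

Implicit Types beta t : R.

Local Notation d n := (edge_sqdist c x (dat n)).
Local Notation w := (gibbs c dat x).

(** The partition function with energies measured from that of [n]; it is the
    inverse of the weight of [n]. *)
Definition rel_partition (n : 'I_N) (beta : R) : R :=
  \sum_(m < N) expR (- (beta * (d m - d n))).

Lemma gibbsE beta n : w beta n = (rel_partition n beta)^-1.
Proof.
rewrite /gibbs -[X in X / _]invrK -invfM mulr_sumr; congr _^-1.
by apply: eq_bigr => m _; rewrite -expRN opprK -expRD mulrBr opprB.
Qed.

Lemma rel_partition_ge1 n beta : 1 <= rel_partition n beta.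
Proof.
rewrite /rel_partition (bigD1 n)//= subrr mulr0 oppr0 expR0 lerDl.
by apply: sumr_ge0 => m _; exact: expR_ge0.
Qed.

Lemma rel_partition_gt0 n beta : 0 < rel_partition n beta.
Proof. exact: lt_le_trans ltr01 (rel_partition_ge1 n beta). Qed.

Lemma gibbs_gt0 beta n : 0 < w beta n.
Proof. by rewrite gibbsE invr_gt0 rel_partition_gt0. Qed.

Lemma gibbs_sum1 beta : (0 < N)%N -> \sum_n w beta n = 1.
Proof.
move=> N0; rewrite -mulr_suml divff// gt_eqF//.
rewrite (bigD1 (Ordinal N0))//= ltr_pwDl ?expR_gt0//.
by apply: sumr_ge0 => m _; exact: expR_ge0.
Qed.

Lemma gibbs_compl beta n : 1 - w beta n = \sum_(m < N | m != n) w beta m.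
Proof.
have N0 : (0 < N)%N := leq_ltn_trans (leq0n n) (ltn_ord n).
by rewrite -(gibbs_sum1 beta N0) (bigD1 n)//= addrAC subrr add0r.
Qed.

(** Reduces every limit of a soft target to limits of the scalar weights. *)
Lemma cvg_soft_target (F : set_system R) (FF : Filter F) (p : 'I_N -> R) :
  (forall n, w beta n @[beta --> F] --> p n) ->
  soft_target c dat x beta @[beta --> F] -->
    (\sum_n p n * (dat n).1, \sum_n p n * (dat n).2).
Proof.
move=> wp; apply: (@cvg_pair _ _ _ F (nbhs (_ : R)) (nbhs (_ : R)));
  (apply: cvg_big => [|n _]; [exact: add_continuous|exact: (cvgMr_tmp (wp n))]).
Qed.

Lemma rel_partition_continuous n : continuous (rel_partition n).
Proof.
move=> beta; apply: cvg_big => [|m _]; first exact: add_continuous.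
apply: (cvg_comp (G := nbhs (- (beta * (d m - d n)))) _ expR);
  last exact: continuous_expR.
by apply: cvgN; apply: cvgMr_tmp; exact: cvg_id.
Qed.

Lemma gibbs_continuous n : continuous (w ^~ n).
Proof.
have -> : w ^~ n = (fun b => (rel_partition n b)^-1).
  by apply/funext => b; exact: gibbsE.
move=> beta; apply: cvgV; first by rewrite gt_eqF ?rel_partition_gt0.
exact: rel_partition_continuous.
Qed.

Lemma gibbs0 n : w 0 n = N%:R^-1.
Proof.
rewrite gibbsE /rel_partition; congr _^-1.
under eq_bigr do rewrite mul0r oppr0 expR0.
by rewrite sumr_const card_ord.
Qed.

(** * High-temperature limit *)

Lemma gibbs_cvg0 n : w beta n @[beta --> 0^'+] --> (N%:R^-1 : R).
Proof.
by apply: cvg_at_right_filter; rewrite -(gibbs0 n); exact: gibbs_continuous.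
Qed.

Lemma soft_target_cvg0 :
  soft_target c dat x beta @[beta --> 0^'+] --> centroid dat.
Proof.
rewrite /centroid !mulr_sumr; apply: cvg_soft_target => n; exact: gibbs_cvg0.
Qed.

(** * Low-temperature limit at a unique nearest neighbour *)

Variable ns : 'I_N.
Hypothesis nsP : nearest c dat x = [set ns].

Lemma nearest_le m : d ns <= d m.
Proof. by have : nearest c dat x ns by rewrite nsP. Qed.

Lemma nearest_lt m : m != ns -> d ns < d m.
Proof.
move=> mns; rewrite lt_neqAle nearest_le andbT; apply/eqP => dE.
have : nearest c dat x m by move=> k; rewrite -dE nearest_le.
by rewrite nsP /= => /eqP; rewrite (negbTE mns).
Qed.

(** By uniqueness every term other than that of [ns] itself decays, so a single
    term, constantly 1, survives. *)
Lemma rel_partition_nearest_cvg : rel_partition ns beta @[beta --> +oo] --> (1 : R).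
Proof.
have -> : 1 = \sum_(m < N) (m == ns)%:R :> R.
  by rewrite (bigD1 ns)//= eqxx big1 ?addr0// => m /negPf->.
apply: cvg_big => [|m _]; first exact: add_continuous.
have [->|mns] := eqVneq m ns.
  by under eq_fun do rewrite subrr mulr0 oppr0 expR0; exact: cvg_cst.
apply: (cvg_comp (G := +oo) (fun b => b * (d m - d ns)) (fun b => expR (- b))).
  apply: gt0_cvgMly; first by rewrite subr_gt0 nearest_lt.
  exact: cvg_id.
exact: cvgr_expR.
Qed.

Lemma gibbs_nearest_cvg : w beta ns @[beta --> +oo] --> (1 : R).
Proof.
under eq_fun do rewrite gibbsE.
have := cvgV (oner_neq0 R) rel_partition_nearest_cvg; rewrite invr1; exact.
Qed.

Lemma gibbs_le_other n beta : n != ns -> w beta n <= 1 - w beta ns.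
Proof.
move=> nns; rewrite gibbs_compl (bigD1 n)//=.
by rewrite lerDl sumr_ge0// => m _; rewrite ltW ?gibbs_gt0.
Qed.

Lemma gibbs_other_cvg n : n != ns -> w beta n @[beta --> +oo] --> (0 : R).
Proof.
move=> nns; apply: (@squeeze_cvgr _ _ _ _ (cst 0) (fun b => 1 - w b ns)).
- by near=> b; rewrite gibbs_le_other// ltW// gibbs_gt0.
- exact: cvg_cst.
- have := cvgB (@cvg_cst _ (1 : R) _ _ _) gibbs_nearest_cvg.
  rewrite subrr; exact.
Unshelve. all: by end_near. Qed.

Lemma soft_target_cvgy : soft_target c dat x beta @[beta --> +oo] --> dat ns.
Proof.
have -> : dat ns = (\sum_n (n == ns)%:R * (dat n).1,
                    \sum_n (n == ns)%:R * (dat n).2).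
  have sumE (v : 'I_N -> R) : \sum_n (n == ns)%:R * v n = v ns.
    rewrite (bigD1 ns)//= eqxx mul1r big1 ?addr0// => m /negPf->.
    by rewrite mul0r.
  by rewrite !sumE; case: (dat ns).
apply: cvg_soft_target => n; have [->|nns] := eqVneq n ns.
  exact: gibbs_nearest_cvg.
exact: gibbs_other_cvg.
Qed.

(** * The gap between the two smallest distances *)

(** The distance of [ns] is a lower bound for all the others, so the sorted
    list starts with it; the sorted remainder gives the other order
    statistics. *)
Lemma ordered_sqdistE j : ordered_sqdist c dat x j =
  nth 0 (d ns :: sort <=%R [seq d n | n <- rem ns (enum 'I_N)]) j.
Proof.
congr nth; apply: (sorted_eq le_trans le_anti).
- exact: sort_le_sorted.
- rewrite /= path_min_sorted; first exact: sort_le_sorted.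
  by apply/allP => y; rewrite mem_sort => /mapP[m _ ->]; exact: nearest_le.
- rewrite perm_sort perm_sym.
  apply: (@perm_trans _ [seq d n | n <- ns :: rem ns (enum 'I_N)]).
    by rewrite /= perm_cons perm_sort.
  by apply: perm_map; rewrite perm_sym perm_to_rem// mem_enum.
Qed.

Lemma ordered_sqdist0 : ordered_sqdist c dat x 0 = d ns.
Proof. by rewrite ordered_sqdistE. Qed.

Hypothesis N1 : (1 < N)%N.

Lemma ordered_sqdist1 : exists2 m, m != ns & ordered_sqdist c dat x 1 = d m.
Proof.
have : ordered_sqdist c dat x 1 \in [seq d n | n <- rem ns (enum 'I_N)].
  rewrite ordered_sqdistE /= -(mem_sort <=%R) mem_nth//.
  rewrite size_sort size_map size_rem ?mem_enum// -cardE card_ord.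
  by rewrite -ltnS prednK// ltnW.
move=> /mapP[m]; rewrite mem_rem_uniq ?enum_uniq// => /andP[/= mns _] ->.
by exists m.
Qed.

Lemma ordered_sqdist1_le m : m != ns -> ordered_sqdist c dat x 1 <= d m.
Proof.
move=> mns; rewrite ordered_sqdistE /=.
set s := sort _ _.
have : d m \in s.
  rewrite mem_sort; apply: (map_f (fun n => d n)).
  by rewrite mem_rem_uniq ?enum_uniq// !inE mns mem_enum.
have : sorted <=%R s by exact: sort_le_sorted.
case: s => //= a s pas; rewrite inE => /predU1P[->//|].
by move/(allP (order_path_min le_trans pas)).
Qed.

Lemma gap_gt0 : 0 < gap c dat x.
Proof.
have [m mns] := ordered_sqdist1.
by rewrite /gap ordered_sqdist0 => ->; rewrite subr_gt0 nearest_lt.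
Qed.

(** Each of the [N.-1] competing weights is at most its numerator divided by
    that of [ns], hence at most the Gibbs factor of the gap. *)
Lemma gibbs_gap_le beta : 0 <= beta ->
  1 - w beta ns <= N.-1%:R * expR (- (beta * gap c dat x)).
Proof.
move=> b0; rewrite gibbs_compl.
have -> : N.-1%:R * expR (- (beta * gap c dat x)) =
          \sum_(m < N | m != ns) expR (- (beta * gap c dat x)).
  by rewrite sumr_const cardC1 card_ord mulr_natl.
apply: ler_sum => m mns.
rewrite gibbsE.
rewrite -[leRHS]invrK lef_pV2 ?posrE ?invr_gt0 ?expR_gt0 ?rel_partition_gt0//.
rewrite -expRN opprK /rel_partition (bigD1 ns)//=.
apply: (@le_trans _ _ (expR (- (beta * (d ns - d m))))).
  by rewrite ler_expR -mulrN ler_wpM2l// opprB /gap ordered_sqdist0 lerB//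
    ordered_sqdist1_le.
by rewrite lerDl sumr_ge0// => k _; exact: expR_ge0.
Qed.

Lemma gibbs_gap_bigO :
  (fun beta : R => 1 - w beta ns : R^o) =O_ (pinfty_nbhs R)
  (fun beta : R => expR (- (beta * gap c dat x)) : R^o).
Proof.
apply/eqO_exP; exists N.-1%:R; first by rewrite ltr0n -ltnS prednK// ltnW.
near=> beta.
have w1 : 0 <= 1 - w beta ns.
  by rewrite gibbsE subr_ge0 invf_le1 ?rel_partition_ge1 ?rel_partition_gt0.
rewrite ger0_norm// ger0_norm ?expR_ge0//; apply: gibbs_gap_le.
by near: beta; exact: nbhs_pinfty_ge.
Unshelve. all: by end_near. Qed.

(** Only the terms of [ns] and of the runner-up are kept in the sum. *)
Lemma gibbs_nearest_le beta :
  w beta ns <= (1 + expR (- (beta * gap c dat x)))^-1.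
Proof.
have [m mns dm] := ordered_sqdist1.
rewrite gibbsE lef_pV2 ?posrE ?rel_partition_gt0 ?addr_gt0 ?expR_gt0//.
rewrite /rel_partition (bigD1 ns)//= subrr mulr0 oppr0 expR0 lerD2l (bigD1 m)//=.
rewrite /gap ordered_sqdist0 dm lerDl sumr_ge0// => k _; exact: expR_ge0.
Qed.

(** Such a weight never exceeds that of [ns], and the two add up to at most
    1. *)
Lemma gibbs_other_le beta n : 0 <= beta -> n != ns -> w beta n <= 2^-1.
Proof.
move=> b0 nns; have wn := gibbs_le_other beta nns.
have : w beta n <= w beta ns.
  rewrite /gibbs ler_wpM2r//.
    by rewrite invr_ge0 sumr_ge0// => k _; exact: expR_ge0.
  by rewrite ler_expR lerN2 ler_wpM2l// nearest_le.
lra.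
Qed.

(** * Terminal inverse temperature *)

Variable eps : R.
Hypotheses (eps0 : 0 < eps) (eps2 : eps < 2^-1).

Lemma resolvedP beta : 0 <= beta ->
  resolved c dat x eps beta <-> 1 - eps <= w beta ns.
Proof.
move=> b0; split=> [[n]|]; last by exists ns.
have [->//|nns wn] := eqVneq n ns.
have := gibbs_other_le b0 nns; have e2 := eps2; lra.
Qed.

(** The set contains all large inverse temperatures; without this its infimum
    could be the conventional value 0. *)
Lemma resolved_has_inf :
  has_inf [set beta | 0 < beta /\ resolved c dat x eps beta].
Proof.
split; last by exists 0 => beta [/ltW].
have e1 : 1 - eps < 1 by rewrite ltrBlDl ltrDr.
have : \forall beta \near +oo, 0 < beta /\ 1 - eps < w beta ns.
  near=> b; split; near: b; first exact: nbhs_pinfty_gt.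
  exact: (cvgr_gt _ gibbs_nearest_cvg).
move=> /filter_ex[b [b0 wb]]; exists b; split=> //; exists ns; exact: ltW.
Unshelve. all: by end_near. Qed.

(** Comes from solving [1 - eps <= (1 + expR (- (beta * gap)))^-1] for
    [beta]. *)
Lemma terminal_beta_ge :
  ln ((1 - eps) / eps) / gap c dat x <= terminal_beta c dat x eps.
Proof.
apply: lb_le_inf; first exact: resolved_has_inf.1.
move=> beta [b0 /(resolvedP (ltW b0)) wb].
have e2 := eps2; have e1 : 0 < 1 - eps by lra.
rewrite ler_pdivrMr ?gap_gt0//.
rewrite -ler_expR lnK ?posrE ?divr_gt0//.
have := le_trans wb (gibbs_nearest_le beta).
rewrite expRN; set y := expR _ => h.
have y0 : 0 < y by exact: expR_gt0.
rewrite ler_pdivrMr//.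
have yE : (1 + y^-1)^-1 = y / (y + 1).
  by rewrite -{2}[y]mulr1 -(divff (lt0r_neq0 y0)); field; lra.
move: h; rewrite yE ler_pdivlMr; lra.
Qed.

Lemma terminal_beta_gt0 : 0 < terminal_beta c dat x eps.
Proof.
apply: lt_le_trans terminal_beta_ge; rewrite divr_gt0 ?gap_gt0// ln_gt0//.
rewrite ltr_pdivlMr//; have e2 := eps2; lra.
Qed.

(** The infimum is attained: if the weight were below [1 - eps] there, it would
    be so on a neighbourhood, which contains resolved values. *)
Lemma terminal_beta_resolved : 1 - eps <= w (terminal_beta c dat x eps) ns.
Proof.
set t := terminal_beta c dat x eps; rewrite leNgt; apply/negP => wt.
have /cvgr_lt/(_ _ wt) := @gibbs_continuous ns t.
move=> /nbhs_ballP[e /= e0 we].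
have [b [b0 /(resolvedP (ltW b0)) wb] bt] := inf_adherent e0 resolved_has_inf.
have tb : t <= b.
  by apply: (ge_inf resolved_has_inf.2); split => //; exact/resolvedP/wb/ltW.
suff /we : ball t e b by rewrite ltNge wb.
by rewrite /ball /= ler0_norm ?subr_le0// opprB ltrBlDl.
Qed.

(** The slack in the weight at [t] leaves room, by continuity, for a smaller
    resolved inverse temperature. *)
Lemma terminal_beta_lt t : 0 < t -> 1 - eps < w t ns ->
  terminal_beta c dat x eps < t.
Proof.
move=> t0 wt.
have wl := cvgr_gt _ (cvg_at_left_filter (@gibbs_continuous ns t)) _ wt.
have : \forall b \near t^'-, b < t /\ 0 < b /\ 1 - eps < w b ns.
  near=> b; split; first by near: b; exact: nbhs_left_lt.
  split; near: b; first exact: nbhs_left_gt.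
  exact: wl.
move=> /filter_ex[b [bt [b0 wb]]]; apply: le_lt_trans bt.
by apply: (ge_inf resolved_has_inf.2); split=> //; exists ns; exact: ltW.
Unshelve. all: by end_near. Qed.

End weights.

(** When every other distance is unchanged, the gap can shrink only if the
    competitor [n2] comes closer.  That strictly increases one term of the
    partition function relative to [ns], so at each positive inverse
    temperature the weight of [ns] is strictly smaller in the second
    configuration. *)
Lemma terminal_beta_lt_close {R : realType} {N : nat} (c eps : R)
    (dat1 dat2 : 'I_N -> R * R) (x1 x2 : R * R) (ns n2 : 'I_N) :
  (1 < N)%N -> 0 < eps -> eps < 2^-1 ->
  nearest c dat1 x1 = [set ns] -> nearest c dat2 x2 = [set ns] -> n2 != ns ->
  (forall n, n != n2 ->
    edge_sqdist c x1 (dat1 n) = edge_sqdist c x2 (dat2 n)) ->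
  gap c dat2 x2 < gap c dat1 x1 ->
  terminal_beta c dat1 x1 eps < terminal_beta c dat2 x2 eps.
Proof.
move=> N1 e0 e2 ns1 ns2 n2ns dE gap21.
have dns : edge_sqdist c x1 (dat1 ns) = edge_sqdist c x2 (dat2 ns).
  by apply: dE; rewrite eq_sym.
(* Otherwise all distances of the second configuration dominate those of the
   first, with the same minimum, and its gap could not be smaller. *)
have dn2 : edge_sqdist c x2 (dat2 n2) < edge_sqdist c x1 (dat1 n2).
  rewrite ltNge; apply/negP => d12; move: gap21; apply/negP; rewrite -leNgt.
  rewrite /gap (ordered_sqdist0 ns1) (ordered_sqdist0 ns2) dns lerD2r.
  have [m mns ->] := ordered_sqdist1 ns2 N1.
  apply: le_trans (ordered_sqdist1_le ns1 mns) _.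
  by have [->//|/dE->] := eqVneq m n2.
have t0 := terminal_beta_gt0 ns2 N1 e0 e2.
apply: (terminal_beta_lt ns1) => //.
apply: le_lt_trans (terminal_beta_resolved ns2 e0 e2) _.
rewrite !gibbsE ltf_pV2 ?posrE ?rel_partition_gt0//.
rewrite /rel_partition (bigD1 n2)//= [ltRHS](bigD1 n2)//=.
apply: ltr_leD; first by rewrite ltr_expR ltrN2 ltr_pM2l// dns ltrD2r.
by apply: ler_sum => m mn2; rewrite dE// dns.
Qed.

(** * Projections of network states *)

Section network.
Context {R : realType} {ne N : nat}.
Variables (C : 'I_ne -> R) (dat : 'I_N -> R * R).
Implicit Types z : 'rV[R]_ne * 'rV[R]_ne.

Lemma edge_sqdistC (c : R) (x y : R * R) :
  edge_sqdist c x y = edge_sqdist c y x.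
Proof. by rewrite /edge_sqdist -sqrrN opprB -[(x.2 - _) ^+ 2]sqrrN opprB. Qed.

Lemma edge_inj z z' : (forall k, edge z k = edge z' k) -> z = z'.
Proof.
case: z z' => [g q] [g' q'] zz'; congr pair; apply/rowP => k;
  by have [] := zz' k.
Qed.

Lemma edge_row (f : 'I_ne -> R * R) k :
  edge (\row_k (f k).1, \row_k (f k).2) k = f k.
Proof. by rewrite /edge !mxE -surjective_pairing. Qed.

Lemma nearest_exists (c : R) (x : R * R) : (0 < N)%N ->
  exists n, nearest c dat x n.
Proof.
move=> N0; case: (arg_minP (i0 := Ordinal N0) (P := predT)
  (fun n => edge_sqdist c x (dat n)) isT) => n _ nP.
by exists n => m; exact: nP.
Qed.

(** The squared distance is a sum over edges and the data constraint is
    imposed edge by edge, so the minimization decouples; for the direct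
    implication a minimizer is compared with its modification on one edge. *)
Lemma argmin_data_statesP z zt : argmin C (data_states dat) z zt <->
  forall k, exists2 n, nearest (C k) dat (edge z k) n & edge zt k = dat n.
Proof.
split=> [[zt_dat zt_min] k|ztP].
  have [n _ nE] := zt_dat k; exists n => // m.
  pose f j := if j == k then dat m else edge zt j.
  have f_dat : data_states dat (\row_j (f j).1, \row_j (f j).2).
    move=> j; rewrite edge_row /f; case: eqP => _; [by exists m|exact: zt_dat].
  have := zt_min _ f_dat.
  rewrite /sqdist (bigD1 k)//= [X in _ <= X -> _](bigD1 k)//=.
  under [X in _ <= _ + X -> _]eq_bigr => j jk do
    rewrite edge_row /f (negbTE jk).
  rewrite edge_row /f eqxx lerD2r -nE.
  by rewrite ![edge_sqdist _ _ (edge z k)]edge_sqdistC.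
split=> [k|z' z'_dat]; first by have [n _ ->] := ztP k; exists n.
apply: ler_sum => k _; have [n nP ->] := ztP k; have [m _ <-] := z'_dat k.
by rewrite ![edge_sqdist _ (dat _) _]edge_sqdistC; exact: nP.
Qed.

Lemma hard_proj_argmin z : (0 < N)%N ->
  argmin C (data_states dat) z (hard_proj C dat z).
Proof.
move=> N0; apply: xgetPex.
have [a aP] := choice (fun k => nearest_exists (C k) (edge z k) N0).
exists (assigned dat a); apply/argmin_data_statesP => k; exists (a k) => //.
exact: (edge_row (dat \o a)).
Qed.

Lemma edge_argmin z zt k ns : nearest (C k) dat (edge z k) = [set ns] ->
  argmin C (data_states dat) z zt -> edge zt k = dat ns.
Proof. by move=> nsP /argmin_data_statesP/(_ k)[n]; rewrite nsP => ->. Qed.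

Lemma edge_soft_proj beta z k :
  edge (soft_proj C dat beta z) k = soft_target (C k) dat (edge z k) beta.
Proof. exact: (edge_row (fun k => soft_target (C k) dat (edge z k) beta)). Qed.

(** Entrywise convergence suffices in a finite-dimensional space: finitely many
    neighbourhood conditions hold simultaneously. *)
Lemma cvg_state (F : set_system R) (FF : Filter F)
    (f : R -> 'rV[R]_ne * 'rV[R]_ne) z :
  (forall k, edge (f t) k @[t --> F] --> edge z k) -> f t @[t --> F] --> z.
Proof.
move=> fz.
have rowP (h : R -> 'rV[R]_ne) (r : 'rV[R]_ne) :
    (forall k, h t ord0 k @[t --> F] --> r ord0 k) -> h t @[t --> F] --> r.
  move=> hr A [P rP PA].
  have : \forall t \near F, forall k, P ord0 k (h t ord0 k).
    by apply: filter_forall => k; exact/hr/rP.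
  by apply: filterS => t tP; apply: PA => i j; rewrite (ord1 i).
rewrite [z]surjective_pairing.
under eq_fun do rewrite [f _]surjective_pairing.
apply: (@cvg_pair _ _ _ F (nbhs z.1) (nbhs z.2)); apply: rowP => k.
  exact: (cvg_comp _ fst (fz k) (@cvg_fst _ _ (nbhs _) (nbhs _) _)).
exact: (cvg_comp _ snd (fz k) (@cvg_snd _ _ (nbhs _) (nbhs _) _)).
Qed.

End network.

(** * Annealing limits and terminal temperature *)

Theorem proposition4p1 (R : realType) (ne N : nat) (hN : (0 < N)%N)
    (dat : 'I_N -> R * R) (C : 'I_ne -> R) (hC : forall k, 0 < C k) :
  (forall (z : 'rV[R]_ne * 'rV[R]_ne) (k : 'I_ne),
    [/\ forall n, gibbs (C k) dat (edge z k) beta n @[beta --> 0^'+]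
          --> (N%:R^-1 : R),
        soft_target (C k) dat (edge z k) beta @[beta --> 0^'+]
          --> centroid dat
      & forall (z' : 'rV[R]_ne * 'rV[R]_ne) (l : R * R),
          soft_target (C k) dat (edge z k) beta @[beta --> 0^'+] --> l <->
          soft_target (C k) dat (edge z' k) beta @[beta --> 0^'+] --> l]) /\
  (forall (A : set ('rV[R]_ne * 'rV[R]_ne)) (sched : nat -> R) (j : nat)
      (k : 'I_ne) (a : 'I_ne -> 'I_N),
    let z := annealed_state C dat A sched a j in
    soft_target (C k) dat (edge z k) beta @[beta --> 0^'+] --> centroid dat) /\
  (forall (z : 'rV[R]_ne * 'rV[R]_ne) (k : 'I_ne) (ns : 'I_N),
    nearest (C k) dat (edge z k) = [set ns] ->
    [/\ gibbs (C k) dat (edge z k) beta ns @[beta --> +oo] --> (1 : R),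
        forall n, n != ns ->
          gibbs (C k) dat (edge z k) beta n @[beta --> +oo] --> (0 : R),
        edge (hard_proj C dat z) k = dat ns,
        edge (soft_proj C dat beta z) k @[beta --> +oo]
          --> edge (hard_proj C dat z) k
      & (1 < N)%N ->
        (fun beta : R => 1 - gibbs (C k) dat (edge z k) beta ns : R^o)
          =O_ (pinfty_nbhs R)
        (fun beta : R => expR (- (beta * gap (C k) dat (edge z k))) : R^o)]) /\
  (forall z : 'rV[R]_ne * 'rV[R]_ne,
    (forall k, exists ns, nearest (C k) dat (edge z k) = [set ns]) ->
    argmin C (data_states dat) z = [set hard_proj C dat z] /\
    soft_proj C dat beta z @[beta --> +oo] --> hard_proj C dat z) /\
  ((1 < N)%N -> forall (k : 'I_ne) (eps : R), 0 < eps -> eps < 2^-1 ->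
    (forall M : R, exists2 delta : R, 0 < delta &
      forall (dat' : 'I_N -> R * R) (x : R * R) (ns : 'I_N),
        nearest (C k) dat' x = [set ns] ->
        gap (C k) dat' x < delta ->
        M < terminal_beta (C k) dat' x eps) /\
    (forall (dat1 dat2 : 'I_N -> R * R) (x1 x2 : R * R) (ns n2 : 'I_N),
        nearest (C k) dat1 x1 = [set ns] ->
        nearest (C k) dat2 x2 = [set ns] ->
        n2 != ns ->
        (forall n, n != n2 -> edge_sqdist (C k) x1 (dat1 n) =
                              edge_sqdist (C k) x2 (dat2 n)) ->
        gap (C k) dat2 x2 < gap (C k) dat1 x1 ->
        terminal_beta (C k) dat1 x1 eps < terminal_beta (C k) dat2 x2 eps)).
Proof.
split=> [z k|].
  split; [exact: gibbs_cvg0|exact: soft_target_cvg0|].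
  move=> z' l.
  have centroidP y : soft_target (C k) dat y beta @[beta --> 0^'+] --> l <->
      l = centroid dat.
    split=> [yl|->]; last exact: soft_target_cvg0.
    apply: (cvg_unique (@norm_hausdorff R (R * R)%type) yl).
    exact: soft_target_cvg0.
  exact: iff_trans (centroidP _) (iff_sym (centroidP _)).
split=> [A sched j k a z|]; first exact: soft_target_cvg0.
split=> [z k ns nsP|].
  have hE : edge (hard_proj C dat z) k = dat ns.
    exact: edge_argmin nsP (hard_proj_argmin C dat z hN).
  split=> //.
  - exact: gibbs_nearest_cvg.
  - by move=> n; exact: gibbs_other_cvg.
  - rewrite hE; under eq_fun do rewrite edge_soft_proj.
    exact: soft_target_cvgy.
  - exact: gibbs_gap_bigO.
split=> [z uniq_nearest|N1 k eps e0 e2].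
  have hz := hard_proj_argmin C dat z hN; split.
    apply/seteqP; split=> [zt ztP|_ ->//] /=.
    apply: edge_inj => k; have [ns nsP] := uniq_nearest k.
    by rewrite (edge_argmin nsP ztP) (edge_argmin nsP hz).
  apply: cvg_state => k; have [ns nsP] := uniq_nearest k.
  rewrite (edge_argmin nsP hz); under eq_fun do rewrite edge_soft_proj.
  exact: soft_target_cvgy.
split=> [M|dat1 dat2 x1 x2 ns n2]; last exact: terminal_beta_lt_close.
set L := ln ((1 - eps) / eps).
have L0 : 0 < L by rewrite ln_gt0// ltr_pdivlMr//; lra.
have M0 : 0 < `|M| + 1 by rewrite ltr_wpDl.
(* With this threshold, [L / gap > `|M| + 1 > M]. *)
exists (L / (`|M| + 1)) => [|dat' x ns nsP gapL]; first exact: divr_gt0.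
apply: lt_le_trans (terminal_beta_ge nsP N1 e0 e2).
rewrite -/L ltr_pdivlMr ?(gap_gt0 nsP)//.
move: gapL; rewrite ltr_pdivlMr// mulrC; apply: le_lt_trans.
by rewrite ler_wpM2r ?ltW ?(gap_gt0 nsP)//; have := ler_norm M; lra.
Qed.
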